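(* Fix an integer $k \geq 1$. There is an $O(n^2)$-time algorithm that, given an $n$-vertex $(k,1)$-polar graph $G$ (together with a $(k,1)$-polar partition $(A,B)$ of its vertex set) and a colouring of its vertices, decides whether the colouring is a clique-colouring of $G$, i.e., whether no clique of $G$ is monochromatic.
   Context: Graphs are finite and simple. A clique of a graph is a maximal set of vertices of size at least 2 inducing a complete graph. A graph $G$ is $(\alpha,1)$-polar if $V(G)$ can be partitioned into sets $A$ and $B$ such that $B$ induces a complete graph and every connected component of $G[A]$ (called a satellite) is a complete graph on at most $\alpha$ vertices. *)

(* Defs.v *)
From mathcomp Require Import all_boot.

Set Implicit Arguments.
Unset Strict Implicit.
Unset Printing Implicit Defensive.

(** * Graphs, (k,1)-polar partitions, clique-colourings *)

Section Graph.
Variables (T : finType) (e : rel T).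

Definition simple_graph : Prop := symmetric e /\ irreflexive e.

Definition complete (S : {set T}) : bool :=
  [forall x in S, forall y in S, (x != y) ==> e x y].

(* Cliques are maximal, and isolated vertices are not cliques. *)
Definition clique (K : {set T}) : bool :=
  maxset (fun S : {set T} => (2 <= #|S|) && complete S) K.

Definition induced (A : {set T}) : rel T :=
  [rel x y | [&& x \in A, y \in A & e x y]].

(* The vertex sets of the connected components of G[A]. *)
Definition satellites (A : {set T}) : {set {set T}} :=
  [set [set y in A | connect (induced A) x y] | x in A].

(* Either side of the partition may be empty. *)
Definition polar_partition (k : nat) (A B : {set T}) : Prop :=
  [/\ A :|: B = [set: T], A :&: B = set0, complete B &
      forall S, S \in satellites A -> complete S /\ #|S| <= k].

Definition monochromatic (col : T -> nat) (K : {set T}) : bool :=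
  [forall x in K, forall y in K, col x == col y].

Definition clique_colouring (col : T -> nat) : bool :=
  [forall K : {set T}, clique K ==> ~~ monochromatic col K].

End Graph.

(** * A word RAM with structured control flow *)

(* A word is a natural number below 2 ^ w.  A program refers to finitely many
   registers by name; the memory is addressed by computed words.  Every
   operation on words costs one unit of time. *)

Inductive expr : Type :=
  | EConst of nat
  | EReg of nat
  | ELoad of expr
  | EAdd of expr & expr
  | ESub of expr & expr
  | EMul of expr & expr
  | EEq of expr & expr
  | ELt of expr & expr.

Inductive cmd : Type :=
  | CSkip
  | CAssign of nat & expr
  | CStore of expr & expr
  | CSeq of cmd & cmd
  | CIf of expr & cmd & cmd
  | CWhile of expr & cmd.

Record state : Type := State { regs : nat -> nat; mem : nat -> nat }.

Definition upd (f : nat -> nat) (i v : nat) : nat -> nat :=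
  fun j => if j == i then v else f j.

(* Addition and multiplication wrap around modulo 2 ^ w; subtraction
   saturates at 0. *)
Fixpoint eval (w : nat) (s : state) (a : expr) : nat :=
  match a with
  | EConst c => c %% 2 ^ w
  | EReg r => regs s r
  | ELoad a1 => mem s (eval w s a1)
  | EAdd a1 a2 => (eval w s a1 + eval w s a2) %% 2 ^ w
  | ESub a1 a2 => eval w s a1 - eval w s a2
  | EMul a1 a2 => (eval w s a1 * eval w s a2) %% 2 ^ w
  | EEq a1 a2 => eval w s a1 == eval w s a2
  | ELt a1 a2 => eval w s a1 < eval w s a2
  end.

Fixpoint ecost (a : expr) : nat :=
  match a with
  | EConst _ | EReg _ => 1
  | ELoad a1 => (ecost a1).+1
  | EAdd a1 a2 | ESub a1 a2 | EMul a1 a2 | EEq a1 a2 | ELt a1 a2 =>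
      (ecost a1 + ecost a2).+1
  end.

(* [exec w p s t s']: with [w]-bit words, [p] started in [s] halts in [s']
   after exactly [t] units of time. *)
Inductive exec (w : nat) : cmd -> state -> nat -> state -> Prop :=
  | ExecSkip s : exec w CSkip s 1 s
  | ExecAssign r a s :
      exec w (CAssign r a) s (ecost a).+1
        (State (upd (regs s) r (eval w s a)) (mem s))
  | ExecStore a1 a2 s :
      exec w (CStore a1 a2) s (ecost a1 + ecost a2).+1
        (State (regs s) (upd (mem s) (eval w s a1) (eval w s a2)))
  | ExecSeq p1 p2 s1 s2 s3 t1 t2 :
      exec w p1 s1 t1 s2 -> exec w p2 s2 t2 s3 ->
      exec w (CSeq p1 p2) s1 (t1 + t2) s3
  | ExecIf a p1 p2 s s' t :
      exec w (if eval w s a != 0 then p1 else p2) s t s' ->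
      exec w (CIf a p1 p2) s ((ecost a).+1 + t) s'
  | ExecWhileEnd a p s :
      eval w s a = 0 ->
      exec w (CWhile a p) s (ecost a).+1 s
  | ExecWhileStep a p s1 s2 s3 t1 t2 :
      eval w s1 a <> 0 ->
      exec w p s1 t1 s2 -> exec w (CWhile a p) s2 t2 s3 ->
      exec w (CWhile a p) s1 ((ecost a).+1 + t1 + t2) s3.

Lemma exec_det w p s t1 s1 t2 s2 :
  exec w p s t1 s1 -> exec w p s t2 s2 -> t1 = t2 /\ s1 = s2.
Proof.
move=> H; elim: H t2 s2 => {p s t1 s1}.
- by move=> s t' s' H; inversion H.
- by move=> r a s t' s' H; inversion H.
- by move=> a1 a2 s t' s' H; inversion H.
- move=> p1 p2 s1 s2 s3 t1 t2 _ IH1 _ IH2 t' s' H.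
  inversion H as [| | |? ? ? ? ? ? ? h1 h2| | |]; subst.
  by case: (IH1 _ _ h1) => -> ?; subst; case: (IH2 _ _ h2) => -> ->.
- move=> a p1 p2 s s1 t _ IH t' s' H.
  inversion H as [| | | |? ? ? ? ? ? h| |]; subst.
  by case: (IH _ _ h) => -> ->.
- by move=> a p s a0 t' s' H; inversion H.
- move=> a p s1 s2 s3 t1 t2 a0 _ IH1 _ IH2 t' s' H.
  inversion H as [| | | | | |? ? ? ? ? ? ? ? h1 h2]; subst=> //.
  by case: (IH1 _ _ h1) => -> ?; subst; case: (IH2 _ _ h2) => -> ->.
Qed.

Definition init (input : seq nat) : state :=
  State (fun=> 0) (fun i => nth 0 input i).

Definition output (s : state) : nat := regs s 0.

(** * Input format and running time *)

(* The number of vertices, the adjacency matrix in row-major order, the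
   indicator vector of A (which determines B) and the colours. *)
Definition encode (n : nat) (e : rel 'I_n) (A : {set 'I_n})
    (col : 'I_n -> nat) : seq nat :=
  n :: [seq nat_of_bool (e i j) | i <- enum 'I_n, j <- enum 'I_n]
    ++ [seq nat_of_bool (i \in A) | i <- enum 'I_n]
    ++ [seq col i | i <- enum 'I_n].

(* Words have at least [c * log2 (n + 2)] bits, and every entry of the input
   fits in one word. *)
Definition word_size_ok (c n w : nat) (input : seq nat) : Prop :=
  (n + 2) ^ c <= 2 ^ w /\ all (fun x => x < 2 ^ w) input.

Definition bigO (f g : nat -> nat) : Prop :=
  exists C n0, forall n, n0 <= n -> f n <= C * g n.

(* Main.v *)
Require Import Defs.
From mathcomp Require Import all_boot zify.

(** A clique contained in [B] is [B] itself, and it is one iff no vertex of [A]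
    is adjacent to all of [B].  Any other clique [K] meets [A] in a nonempty
    subset [X] of one satellite [S], and [K] consists of [X] and the common
    neighbours of [X] in [B]; conversely such a set is maximal iff every vertex
    of [S] outside [X] misses some vertex of it.  The satellite of a vertex [x]
    of [A] is its closed neighbourhood in [A] and has at most [k] vertices, so
    for each [x] it is found in time [O(k n)], and each of the at most [2 ^ k]
    sets [X] is tested in time [O(k n)].

    The algorithm is a first-order formula over the vertices whose quantifiers
    are compiled to loops: a formula of quantifier depth [q] runs in time
    [O(n ^ q)], and depth 2 suffices. *)

Set Implicit Arguments.
Unset Strict Implicit.
Unset Printing Implicit Defensive.

(** * Formulas over the vertices, their compilation and their cost *)

Inductive form : Type :=
  | Atom of expr
  | Not of form
  | And of form & form
  | Pick of form & form.

Definition size_expr : expr := ELoad (EConst 0).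

(* [Pick f g] binds register [d] to the first vertex satisfying [f], or to the
   number of vertices if there is none, and continues with [g].  The memory is
   never written, so it is a parameter. *)
Fixpoint den (w : nat) (m rg : nat -> nat) (d : nat) (f : form) : bool :=
  match f with
  | Atom a => eval w (State rg m) a != 0
  | Not f1 => ~~ den w m rg d f1
  | And f1 f2 => den w m rg d f1 && den w m rg d f2
  | Pick f1 f2 =>
      den w m (upd rg d (find (fun y => den w m (upd rg d y) d.+1 f1)
                              (iota 0 (m 0)))) d.+1 f2
  end.

(** The test packs two conditions into one comparison: it holds iff register 0 is zero and register
    [d] is below the number of vertices. The increment is skipped at a witness, so that register [d]
    still holds it on exit. *)
Definition pick_loop (d : nat) (p : cmd) : cmd :=
  CWhile (ELt (EReg 0) (ELt (EReg d) size_expr))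
    (CSeq p (CIf (EReg 0) CSkip (CAssign d (EAdd (EReg d) (EConst 1))))).

(* Register 0 receives the truth value and registers [d], [d + 1], ... are
   scratch space. *)
Fixpoint compile (d : nat) (f : form) : cmd :=
  match f with
  | Atom a => CAssign 0 a
  | Not f1 => CSeq (compile d f1) (CAssign 0 (EEq (EReg 0) (EConst 0)))
  | And f1 f2 => CSeq (compile d f1) (CIf (EReg 0) (compile d f2) CSkip)
  | Pick f1 f2 =>
      CSeq (CAssign 0 (EConst 0))
        (CSeq (CAssign d (EConst 0))
           (CSeq (pick_loop d (compile d.+1 f1)) (compile d.+1 f2)))
  end.

(** An upper bound on the time. A loop test costs 7, and the conditional with its increment costs 6,
    whence 13 per iteration; the 11 is the failing last test plus two initial assignments of cost
    2. *)
Fixpoint cost (n : nat) (f : form) : nat :=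
  match f with
  | Atom a => (ecost a).+1
  | Not f1 => cost n f1 + 4
  | And f1 f2 => cost n f1 + cost n f2 + 3
  | Pick f1 f2 => n * (cost n f1 + 13) + cost n f2 + 11
  end.

(** Loop nesting: the continuation of [Pick] runs once, after the loop, and therefore adds no
    level. *)
Fixpoint depth (f : form) : nat :=
  match f with
  | Atom _ => 0
  | Not f1 => depth f1
  | And f1 f2 => maxn (depth f1) (depth f2)
  | Pick f1 f2 => maxn (depth f1).+1 (depth f2)
  end.

(** Register 0 is excluded because every truth value overwrites it, and registers from [d] on
    because they are scratch. *)
Fixpoint expr_ok (d : nat) (a : expr) : bool :=
  match a with
  | EConst _ => true
  | EReg r => 0 < r < d
  | ELoad a1 => expr_ok d a1
  | EAdd a1 a2 | ESub a1 a2 | EMul a1 a2 | EEq a1 a2 | ELt a1 a2 =>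
      expr_ok d a1 && expr_ok d a2
  end.

Fixpoint form_ok (d : nat) (f : form) : bool :=
  match f with
  | Atom a => expr_ok d a
  | Not f1 => form_ok d f1
  | And f1 f2 => form_ok d f1 && form_ok d f2
  | Pick f1 f2 => form_ok d.+1 f1 && form_ok d.+1 f2
  end.

(** Powers of [n.+1] are positive and increase with the exponent even for [n = 0], so they absorb
    all additive constants. *)
Lemma cost_polynomial f : exists C, forall n, cost n f <= C * n.+1 ^ depth f.
Proof.
elim: f => [a|f [C HC]|f [C HC] g [D HD]|f [C HC] g [D HD]] /=.
- by exists (ecost a).+1 => n; rewrite expn0 muln1.
- exists (C + 4) => n; rewrite mulnDl leq_add //.
  by rewrite -{1}(muln1 4) leq_mul2l /= expn_gt0.
- exists (C + D + 3) => n; rewrite !mulnDl !leq_add //.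
  + by apply: leq_trans (HC n) _; rewrite leq_mul2l leq_pexp2l ?leq_maxl ?orbT.
  + by apply: leq_trans (HD n) _; rewrite leq_mul2l leq_pexp2l ?leq_maxr ?orbT.
  + by rewrite -{1}(muln1 3) leq_mul2l /= expn_gt0.
- exists (C + 13 + D + 11) => n; rewrite !(mulnDl _ _ (n.+1 ^ _)) -mulnDl.
  rewrite !leq_add //.
  + apply: leq_trans (_ : (C + 13) * n.+1 ^ (depth f).+1 <= _); last first.
      by rewrite leq_mul2l leq_pexp2l ?leq_maxl ?orbT.
    rewrite expnS mulnCA leq_mul // mulnDl leq_add //.
    by rewrite -{1}(muln1 13) leq_mul2l /= expn_gt0.
  + by apply: leq_trans (HD n) _; rewrite leq_mul2l leq_pexp2l ?leq_maxr ?orbT.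
  + by rewrite -{1}(muln1 11) leq_mul2l /= expn_gt0.
Qed.

(** * Correctness of the compiled programs *)

Definition agree (d : nat) (rg rg' : nat -> nat) : Prop :=
  forall j, 0 < j < d -> rg' j = rg j.

Lemma agree_upd d rg rg' v :
  agree d rg rg' -> agree d.+1 (upd rg d v) (upd rg' d v).
Proof.
move=> H j /andP[j0]; rewrite ltnS leq_eqVlt /upd => /predU1P[->|jd].
  by rewrite eqxx.
by rewrite (ltn_eqF jd) H ?j0.
Qed.

Lemma eval_agree w m d a rg rg' : expr_ok d a -> agree d rg rg' ->
  eval w (State rg' m) a = eval w (State rg m) a.
Proof.
move=> + H; elim: a => //= [a IH|a IHa b IHb|a IHa b IHb|a IHa b IHb
  |a IHa b IHb|a IHa b IHb].
- by move=> /IH ->.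
all: by case/andP=> /IHa -> /IHb ->.
Qed.

(** Truth depends on the bound registers alone, so it survives the changes that earlier code makes
    to register 0 and to the scratch registers. *)
Lemma den_agree w m d f rg rg' : form_ok d f -> agree d rg rg' ->
  den w m rg' d f = den w m rg d f.
Proof.
elim: f d rg rg' => [a|f IH|f IHf g IHg|f IHf g IHg] d rg rg' /=.
- by move=> okf H; rewrite (eval_agree _ _ okf H).
- by move=> okf H; rewrite (IH _ rg).
- by case/andP=> okf okg H; rewrite (IHf _ rg) ?(IHg _ rg).
- case/andP=> okf okg H; rewrite -(IHg _ _ _ okg (agree_upd _ H)).
  congr (den _ _ (upd _ _ _) _ _); apply: eq_find => y /=.
  exact: IHf okf (agree_upd _ H).
Qed.

Definition runs (w : nat) (m : nat -> nat) (d : nat) (f : form) : Prop :=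
  forall rg, exists t rg',
    [/\ exec w (compile d f) (State rg m) t (State rg' m),
        t <= cost (m 0) f,
        (rg' 0 != 0) = den w m rg d f &
        agree d rg rg'].

(** Induction on the number [j] of untested candidates, [y] being the current one; the invariant is
    that register 0 is zero at the loop test. *)
Lemma pick_loop_correct w m d f rg y j :
    0 < d -> m 0 < 2 ^ w -> form_ok d.+1 f -> runs w m d.+1 f ->
    y + j = m 0 -> rg 0 = 0 -> rg d = y ->
  exists t rg',
    [/\ exec w (pick_loop d (compile d.+1 f)) (State rg m) t (State rg' m),
        t <= j * (cost (m 0) f + 13) + 7,
        rg' d = y + find (fun z => den w m (upd rg d z) d.+1 f) (iota y j) &
        agree d rg rg'].
Proof.
move=> d_gt0 n_lt okf runf.
elim: j y rg => [|j IH] y rg yj rg0 rgd.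
  exists 7, rg; split=> //; last by rewrite rgd addn0.
  by apply: ExecWhileEnd; rewrite /= rg0 rgd mod0n -yj addn0 ltnn.
have ylt : y < m 0 by rewrite -yj addnS ltnS leq_addr.
have test : eval w (State rg m) (ELt (EReg 0) (ELt (EReg d) size_expr)) <> 0.
  by rewrite /= rg0 rgd mod0n ylt.
have [t1 [rg1 [ex1 tle1 res1 ag1]]] := runf rg.
have rg1d : rg1 d = y by rewrite ag1 // d_gt0 ltnS leqnn.
have -> : find (fun z => den w m (upd rg d z) d.+1 f) (iota y j.+1)
  = if rg1 0 != 0 then 0
    else (find (fun z => den w m (upd rg d z) d.+1 f) (iota y.+1 j)).+1.
  rewrite /= res1 (_ : den _ _ (upd rg d y) _ _ = den w m rg d.+1 f) //.
  apply: den_agree => // i _; rewrite /upd; case: eqP => // ->.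
  by rewrite rgd.
have agd : agree d rg rg1.
  by move=> i /andP[i0 id]; rewrite ag1 // i0 ltnS ltnW.
case: ifPn => found.
  exists (7 + (t1 + 3) + 7), rg1; split=> //; last by rewrite rg1d addn0.
    apply: ExecWhileStep (test) _ _.
      apply: ExecSeq ex1 _; apply: (@ExecIf _ _ _ _ _ _ 1).
      rewrite /= found; exact: ExecSkip.
    (* The inner comparison is at most 1, hence never above a nonzero register 0. *)
    by apply: ExecWhileEnd; apply/eqP; rewrite eqb0 -leqNgt (leq_trans (leq_b1 _)) // lt0n.
  by rewrite mulSn; lia.
have rg10 : rg1 0 = 0 by apply/eqP; rewrite -[_ == _]negbK.
have [|||t2 [rg2 [ex2 tle2 res2 ag2]]] :=
    IH y.+1 (upd rg1 d y.+1).
- by rewrite addSnnS.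
- by rewrite /upd (ltn_eqF d_gt0).
- by rewrite /upd eqxx.
exists (7 + (t1 + 6) + t2), rg2; split.
- apply: ExecWhileStep (test) _ ex2.
  apply: ExecSeq ex1 _; apply: (@ExecIf _ _ _ _ _ _ 4).
  rewrite /= rg10 /=.
  (* No wrap-around: [y + 1] is at most the number of vertices, which fits in a word. *)
  have -> : upd rg1 d y.+1
     = upd (regs (State rg1 m)) d (eval w (State rg1 m) (EAdd (EReg d) (EConst 1))).
    rewrite /= rg1d modnDmr addn1 modn_small //; exact: leq_ltn_trans n_lt.
  exact: ExecAssign.
- by rewrite mulSn; lia.
- rewrite res2 addSnnS; congr (_ + _.+1); apply: eq_find => z.
  apply: den_agree => // i /andP[i0 id]; rewrite /upd.
  by case: eqP => // /eqP ne; rewrite agd // i0 ltn_neqAle ne -ltnS.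
- move=> i ib; rewrite ag2 // /upd; case/andP: (ib) => _ id.
  by rewrite (ltn_eqF id) agd.
Qed.

(** Structural induction on [f]. The condition [0 < d] keeps the truth value in register 0 apart
    from the variables, and [m 0 < 2 ^ w] lets the loop counters reach the number of vertices. *)
Lemma compile_correct w m d f :
  0 < d -> m 0 < 2 ^ w -> form_ok d f -> runs w m d f.
Proof.
move=> + n_lt; elim: f d => [a|f IH|f IHf g IHg|f IHf g IHg] d d_gt0 /= okf rg.
- exists (ecost a).+1, (upd rg 0 (eval w (State rg m) a)); split=> //.
  + exact: ExecAssign.
  + by move=> [|j] // /andP[].
- have [t [rg' [ex tle res ag]]] := IH d d_gt0 okf rg.
  exists (t + 4), (upd rg' 0 (rg' 0 == 0)); split.
  + apply: ExecSeq ex _; have -> : (rg' 0 == 0) = eval w (State rg' m)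
        (EEq (EReg 0) (EConst 0)) :> nat by rewrite /= mod0n.
    exact: ExecAssign.
  + by rewrite leq_add2r.
  + by rewrite /upd eqxx /= -res eqb0.
  + by move=> [|j] // jd; exact: ag.
- case/andP: okf => okf okg.
  have [t [rg1 [ex tle res ag]]] := IHf d d_gt0 okf rg.
  case: (boolP (rg1 0 != 0)) => r0.
    have [t2 [rg2 [ex2 tle2 res2 ag2]]] := IHg d d_gt0 okg rg1.
    exists (t + (2 + t2)), rg2; split.
    + by apply: ExecSeq ex _; apply: ExecIf; rewrite /= r0.
    + by rewrite /=; lia.
    + by rewrite /= -res r0 res2 (den_agree _ _ okg ag).
    + by move=> j jd; rewrite ag2 ?ag.
  exists (t + (2 + 1)), rg1; split=> //.
  + by apply: ExecSeq ex _; apply: ExecIf; rewrite /= (negbTE r0); exact: ExecSkip.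
  + by rewrite /=; lia.
  + by rewrite /= -res (negbTE r0).
- case/andP: okf => okf okg.
  have rgd : upd (upd rg 0 0) d 0 d = 0 by rewrite /upd eqxx.
  have rg0 : upd (upd rg 0 0) d 0 0 = 0 by rewrite /upd (ltn_eqF d_gt0).
  have [t1 [rg1 [ex1 tle1 res1 ag1]]] :=
    pick_loop_correct d_gt0 n_lt okf (IHf d.+1 isT okf) (add0n _) rg0 rgd.
  have [t2 [rg2 [ex2 tle2 res2 ag2]]] := IHg d.+1 isT okg rg1.
  have ag01 : agree d rg rg1.
    by move=> j jb; rewrite ag1 // /upd; case: eqP jb => [->|_]; [rewrite ltnn andbF|case: j].
  exists (2 + (2 + (t1 + t2))), rg2; split.
  + apply: ExecSeq (_ : exec _ _ _ _ (State (upd rg 0 0) m)) _.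
      rewrite -[X in upd _ _ X](mod0n (2 ^ w)); exact: ExecAssign.
    apply: ExecSeq (_ : exec _ _ _ _ (State (upd (upd rg 0 0) d 0) m)) _.
      rewrite -[X in upd _ d X](mod0n (2 ^ w)); exact: ExecAssign.
    exact: ExecSeq ex1 ex2.
  + by rewrite /=; lia.
  + rewrite res2 /=; apply: den_agree okg _ => j /andP[j0].
    rewrite ltnS leq_eqVlt => /predU1P[->|jd].
      rewrite res1 add0n [RHS]/upd eqxx; apply: eq_find => y.
      apply: den_agree okf _ => i /andP[i0 _].
      by rewrite /upd; case: eqP => // _; case: i i0.
    by rewrite [RHS]/upd (ltn_eqF jd) ag01 ?j0.
  + by move=> j /andP[j0 jd]; rewrite ag2 ?ag01 ?j0 // ltnS ltnW.
Qed.

(** * Monochromatic cliques of a polar graph *)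

Section Polar.
Variables (T : finType) (e : rel T) (k : nat) (A B : {set T}).
Hypothesis e_sym : symmetric e.

Lemma completeP (S : {set T}) :
  reflect {in S &, forall x y, x != y -> e x y} (complete e S).
Proof.
apply: (iffP forall_inP) => [H x y xS yS|H x xS].
  exact: implyP (forall_inP (H x xS) y yS).
by apply/forall_inP => y yS; apply/implyP; apply: H.
Qed.

(** Completeness passes to subsets, so maximality can be tested by adding one vertex at a time. *)
Lemma cliqueP (K : {set T}) :
  reflect [/\ 2 <= #|K|, complete e K &
             forall z, z \notin K -> exists2 y, y \in K & ~~ e y z]
          (clique e K).
Proof.
apply: (iffP maxsetP) => [[/andP[K2 Kc] Kmax]|[K2 Kc Kmax]].
  split=> // z zK; apply/exists_inP; rewrite -negb_forall_in.
  apply/negP => /forall_inP adjz; move: zK.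
  rewrite -(Kmax (z |: K)) ?setU11 ?subsetUr //.
  rewrite (leq_trans K2) ?subset_leq_card ?subsetUr //=.
  apply/completeP => x y /setU1P[->|xK] /setU1P[->|yK]; rewrite ?eqxx //.
  - by rewrite e_sym adjz.
  - by rewrite adjz.
  - exact: (completeP _ Kc).
split=> [|L /andP[_ Lc] KL]; first by rewrite K2.
apply/eqP; rewrite eqEsubset KL andbT; apply/subsetP => z zL.
apply: contraT => zK; have [y yK /negP[]] := Kmax z zK.
apply: (completeP _ Lc _ _ (subsetP KL y yK) zL).
by apply: contraNneq zK => <-.
Qed.

Lemma monochromaticP (col : T -> nat) x (K : {set T}) : x \in K ->
  reflect {in K, forall y, col y = col x} (monochromatic col K).
Proof.
move=> xK; apply: (iffP forall_inP) => [H y yK|H y yK].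
  exact/eqP/(forall_inP (H y yK)).
by apply/forall_inP => z zK; rewrite !H.
Qed.

(** Satellites are complete, so for [x] in [A] this closed neighbourhood is its satellite, obtained
    without a search for connected components. *)
Definition satellite_of (x : T) : {set T} :=
  [set y in A | (y == x) || e x y].

(* The candidate clique meeting [A] in [X]. *)
Definition extension (X : {set T}) : {set T} :=
  X :|: [set b in B | [forall z in X, e b z]].

(** This expresses that [B] is a monochromatic clique, with quantifiers over single vertices only so
    that it translates into a formula. *)
Definition bad_side (col : T -> nat) : bool :=
  [&& [forall x, (x \in B) ==> [forall y, (y \in B) ==> (col x == col y)]],
      [exists x, (x \in B) && [exists y, (y \in B) && (x != y)]] &
      [forall x, (x \in A) ==> [exists y, (y \in B) && ~~ e x y]]].

(** For [x] in [A] and [X] inside its satellite, this expresses that [extension X] is a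
    monochromatic clique; maximality is tested against the satellite alone. *)
Definition bad_trace (col : T -> nat) (x : T) (X : {set T}) : bool :=
  [&& x \in X,
      [exists y, (y \in extension X) && (y != x)],
      [forall y, (y \in extension X) ==> (col y == col x)] &
      [forall z, (z \in satellite_of x) ==>
        (z \in X) || [exists y, (y \in extension X) && ~~ e y z]]].

Hypothesis polarAB : polar_partition e k A B.

Lemma notinA x : (x \notin A) = (x \in B).
Proof.
have [/setP/(_ x) + /setP/(_ x) + _ _] := polarAB.
by rewrite !inE; case: (x \in A); case: (x \in B).
Qed.

Let completeB : complete e B. Proof. by case: polarAB. Qed.

(** An edge is a path, so the closed neighbourhood lies in the connected component, which is
    complete and has at most [k] vertices. *)
Let subset_satellite x : x \in A ->
  exists2 S : {set T}, satellite_of x \subset S & complete e S /\ #|S| <= k.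
Proof.
move=> xA; have [_ _ _ HS] := polarAB.
exists [set y in A | connect (induced e A) x y]; last exact/HS/imset_f.
apply/subsetP => y; rewrite !inE => /andP[yA /predU1P[->|exy]].
  by apply/andP; split; [exact: xA | exact: connect0].
by apply/andP; split; [exact: yA | apply: connect1; exact/and3P].
Qed.

Lemma satellite_complete x : x \in A -> complete e (satellite_of x).
Proof.
move=> /subset_satellite[S sub [/completeP Sc _]]; apply/completeP => y z ys zs.
by apply: Sc; apply: (subsetP sub).
Qed.

Lemma satellite_card x : x \in A -> #|satellite_of x| <= k.
Proof.
by move=> /subset_satellite[S sub [_]]; apply/leq_trans/subset_leq_card.
Qed.

Lemma bad_side_clique col : bad_side col ->
  clique e B /\ monochromatic col B.
Proof.
case/and3P=> /forallP mono /existsP[x /andP[xB /existsP[y /andP[yB xy]]]] maxB.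
split; last first.
  apply/(monochromaticP _ xB) => z zB; apply/eqP.
  exact: (implyP (forallP (implyP (mono z) zB) x) xB).
apply/cliqueP; split=> //; first by apply/card_gt1P; exists x, y.
move=> z; rewrite -notinA negbK => zA.
have /existsP[b /andP[bB nadj]] := implyP (forallP maxB z) zA.
by exists b; rewrite // e_sym.
Qed.

Lemma bad_trace_clique col x (X : {set T}) :
    x \in A -> X \subset satellite_of x -> bad_trace col x X ->
  clique e (extension X) /\ monochromatic col (extension X).
Proof.
move=> xA XS /and4P[xX /existsP[y /andP[yK yx]] mono maxX].
have XA z : z \in X -> z \in A by move=> /(subsetP XS); rewrite inE => /andP[].
have xK : x \in extension X by rewrite inE xX.
split; last first.
  apply/(monochromaticP _ xK) => z zK; apply/eqP; exact: (implyP (forallP mono z)).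
apply/cliqueP; split.
- by apply/card_gt1P; exists x, y; rewrite eq_sym.
- apply/completeP => u v; rewrite !inE.
  move=> /orP[uX|/andP[uB /forall_inP uadj]] /orP[vX|/andP[vB /forall_inP vadj]].
  + by apply: (completeP _ (satellite_complete xA)); apply: (subsetP XS).
  + by rewrite e_sym vadj.
  + by rewrite uadj.
  + exact: (completeP _ completeB).
(* A non-neighbour [z] of [x] is excluded by [x] itself. A neighbour in [A] belongs to the
   satellite, where the last condition of [bad_trace] applies; a vertex of [B] outside the extension
   misses a vertex of [X] by definition. *)
- move=> z zK; case: (boolP (e x z)) => xz; last by exists x.
  case: (boolP (z \in A)) => [zA|]; last rewrite notinA => zB.
    have zS : z \in satellite_of x by rewrite inE zA xz orbT.
    case/orP: (implyP (forallP maxX z) zS) => [zX|/existsP[u /andP[]]].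
      by move: zK; rewrite inE zX.
    by exists u.
  move: zK; rewrite !inE zB negb_or /= negb_forall_in => /andP[_].
  case/exists_inP=> u uX; rewrite e_sym => uz; exists u => //.
  by rewrite inE uX.
Qed.

(** If [K] avoids [A], it lies in the complete set [B] and equals it by maximality. Otherwise any
    [x] in [K :&: A] works, with [X] equal to [K :&: A]. *)
Lemma monochromatic_clique_bad col (K : {set T}) :
    clique e K -> monochromatic col K ->
  bad_side col \/ exists2 x, x \in A &
    exists2 X : {set T}, X \subset satellite_of x & bad_trace col x X.
Proof.
move=> /cliqueP[/card_gt1P[u [v [uK vK uv]]] Kc Kmax] mono.
have Kadj := completeP _ Kc.
case: (boolP (K :&: A == set0)) => [/eqP KA|/set0Pn[x]].
  left; have KB z : z \in K -> z \in B.
    by move=> zK; rewrite -notinA; have := in_set0 z; rewrite -KA inE zK /= => ->.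
  have BK z : z \in B -> z \in K.
    move=> zB; apply: contraT => zK; have [y yK /negP[]] := Kmax z zK.
    by apply: (completeP _ completeB _ _ (KB _ yK) zB); apply: contraNneq zK => <-.
  apply/and3P; split.
  - apply/forallP => x; apply/implyP => /BK xK.
    apply/forallP => y; apply/implyP => /BK yK.
    exact: (forall_inP (forall_inP mono x xK) y yK).
  - apply/existsP; exists u; rewrite KB //=.
    by apply/existsP; exists v; rewrite KB.
  - apply/forallP => x; apply/implyP => xA.
    have [|y yK nadj] := Kmax x; first by apply/negP => /KB; rewrite -notinA xA.
    by apply/existsP; exists y; rewrite KB // e_sym.
rewrite inE => /andP[xK xA]; right; exists x => //; exists (K :&: A).
  apply/subsetP => y; rewrite !inE => /andP[yK ->] /=.
  by have [//|xy] := eqVneq y x; rewrite Kadj // eq_sym.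
have -> : bad_trace col x (K :&: A) =
   [&& x \in K :&: A, [exists y, (y \in K) && (y != x)],
      [forall y, (y \in K) ==> (col y == col x)] &
      [forall z, (z \in satellite_of x) ==>
        (z \in K :&: A) || [exists y, (y \in K) && ~~ e y z]]].
  (* A vertex of [B] adjacent to all of [K :&: A] is adjacent to every other vertex of [K], since
     [B] is complete, and so lies in [K] by maximality. *)
  rewrite /bad_trace; have -> // : extension (K :&: A) = K.
  apply/setP => y; rewrite !inE -notinA; case: (boolP (y \in A)) => yA /=.
    by rewrite orbF andbT.
  rewrite andbF /=; apply/forall_inP/idP => [adjy|yK z]; last first.
    rewrite inE => /andP[zK zA]; apply: Kadj => //.
    by apply: contraNneq yA => ->.
  apply: contraT => yK; have [z zK /negP[]] := Kmax y yK.
  case: (boolP (z \in A)) => zA; first by rewrite e_sym adjy // inE zK.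
  apply: (completeP _ completeB); rewrite -?notinA //.
  by apply: contraNneq yK => <-.
rewrite inE xK xA /=; apply/and3P; split.
- apply/existsP; have [vx|] := eqVneq v x; last by exists v; rewrite vK.
  by exists u; rewrite uK -vx.
- apply/forallP => y; apply/implyP => yK.
  exact: (forall_inP (forall_inP mono y yK) x xK).
- apply/forallP => z; apply/implyP; rewrite !inE => /andP[-> _].
  rewrite andbT; case: (boolP (z \in K)) => //= zK; have [y yK nadj] := Kmax z zK.
  by apply/existsP; exists y; rewrite yK.
Qed.

(** The criterion that the algorithm evaluates. Its only quantifier over sets ranges over the
    subsets of a set of at most [k] vertices. *)
Lemma clique_colouring_bad col :
  clique_colouring e col = ~~ bad_side col &&
    [forall x, (x \in A) ==>
      ~~ [exists X : {set T}, (X \subset satellite_of x) && bad_trace col x X]].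
Proof.
apply/forallP/andP => [H|[/negP ns /forallP nt] K].
  have nomono K : clique e K /\ monochromatic col K -> False.
    by case=> Kc Km; have := H K; rewrite Kc Km.
  split; first by apply/negP => /bad_side_clique/nomono.
  apply/forallP => x; apply/implyP => xA; apply/existsP => -[X /andP[XS]].
  by move=> /(bad_trace_clique xA XS)/nomono.
apply/implyP => Kc; apply/negP => Km.
case: (monochromatic_clique_bad Kc Km) => [/ns //|[x xA [X XS bt]]].
by move: (implyP (nt x) xA) => /existsP[]; exists X; rewrite XS.
Qed.

End Polar.

(** * Derived connectives and quantifiers *)

Definition Or (f g : form) : form := Not (And (Not f) (Not g)).
Definition Imp (f g : form) : form := Not (And f (Not g)).
Definition ands (l : seq form) : form :=
  foldr And (Atom (EEq (EConst 0) (EConst 0))) l.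
Definition ors (l : seq form) : form := Not (ands (map Not l)).
(** A search for a counterexample: register [d] ends up equal to the number of vertices exactly when
    there is none. *)
Definition All (d : nat) (f : form) : form :=
  Pick (Not f) (Atom (EEq (EReg d) size_expr)).
Definition Ex (d : nat) (f : form) : form := Not (All d (Not f)).

Lemma den_Not w m rg d f : den w m rg d (Not f) = ~~ den w m rg d f.
Proof. by []. Qed.

Lemma den_And w m rg d f g :
  den w m rg d (And f g) = den w m rg d f && den w m rg d g.
Proof. by []. Qed.

Lemma den_Pick w m rg d f g :
  den w m rg d (Pick f g) =
  den w m (upd rg d (find (fun y => den w m (upd rg d y) d.+1 f)
                          (iota 0 (m 0)))) d.+1 g.
Proof. by []. Qed.

Lemma all_cons (T : Type) (p : pred T) x s : all p (x :: s) = p x && all p s.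
Proof. by []. Qed.

Lemma den_Or w m rg d f g :
  den w m rg d (Or f g) = den w m rg d f || den w m rg d g.
Proof. by rewrite /= -negb_or negbK. Qed.

Lemma den_Imp w m rg d f g :
  den w m rg d (Imp f g) = (den w m rg d f ==> den w m rg d g).
Proof. by rewrite /= negb_and negbK implybE. Qed.

Lemma den_ands w m rg d l : den w m rg d (ands l) = all (den w m rg d) l.
Proof. by elim: l => [|f l IH] /=; rewrite ?eqxx // -IH. Qed.

Lemma den_ors w m rg d l : den w m rg d (ors l) = has (den w m rg d) l.
Proof.
rewrite [LHS]/= den_ands all_map -has_predC; apply: eq_has => f.
by rewrite /= negbK.
Qed.

Lemma depth_ands b l : all (fun f => depth f <= b) l -> depth (ands l) <= b.
Proof. by elim: l => //= f l IH /andP[fb /IH lb]; rewrite geq_max fb. Qed.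

Lemma depth_ors b l : all (fun f => depth f <= b) l -> depth (ors l) <= b.
Proof. by move=> lb; apply: depth_ands; rewrite all_map. Qed.

Lemma form_ok_ands d l : form_ok d (ands l) = all (form_ok d) l.
Proof. by elim: l => //= f l ->. Qed.

Lemma form_ok_ors d l : form_ok d (ors l) = all (form_ok d) l.
Proof. by rewrite /= form_ok_ands all_map. Qed.

Lemma den_All w m rg d f n : m 0 = n ->
  den w m rg d (All d f) = [forall y : 'I_n, den w m (upd rg d y) d.+1 f].
Proof.
move=> m0; rewrite /= mod0n m0 {1}/upd eqxx eqb0 negbK.
have -> : (find (fun y => ~~ den w m (upd rg d y) d.+1 f) (iota 0 n) == n)
  = ~~ has (fun y => ~~ den w m (upd rg d y) d.+1 f) (iota 0 n).
  by rewrite has_find size_iota; have := find_size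
     (fun y => ~~ den w m (upd rg d y) d.+1 f) (iota 0 n); rewrite size_iota; lia.
rewrite -all_predC; apply/allP/forallP => [H y|H y].
  by have := H y; rewrite mem_iota ltn_ord /= negbK => ->.
by rewrite mem_iota /= negbK => yn; exact: (H (Ordinal yn)).
Qed.

Lemma den_Ex w m rg d f n : m 0 = n ->
  den w m rg d (Ex d f) = [exists y : 'I_n, den w m (upd rg d y) d.+1 f].
Proof.
move=> m0; rewrite -[LHS]/(~~ den w m rg d (All d (Not f))) (den_All _ _ _ _ m0).
rewrite negb_forall.
by apply: eq_existsb => y /=; rewrite negbK.
Qed.

(** * The formula for clique-colourings *)

Definition adj_expr (a b : expr) : expr :=
  ELoad (EAdd (EConst 1) (EAdd (EMul a size_expr) b)).
Definition inA_expr (a : expr) : expr :=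
  ELoad (EAdd (EConst 1) (EAdd (EMul size_expr size_expr) a)).
(** The colours come after the size in cell 0, the [n ^ 2] matrix entries and the [n] indicators of
    [A]. *)
Definition col_expr (a : expr) : expr :=
  ELoad (EAdd (EConst 1)
           (EAdd (EMul size_expr size_expr) (EAdd size_expr a))).

Definition InA (a : expr) : form := Atom (inA_expr a).
Definition InB (a : expr) : form := Not (InA a).
Definition SameCol (a b : expr) : form := Atom (EEq (col_expr a) (col_expr b)).
Definition Eq (a b : expr) : form := Atom (EEq a b).
(** Guards against the padding value [n], for which an adjacency test would read an unrelated
    cell. *)
Definition IsVertex (a : expr) : form := Atom (ELt a size_expr).
Definition Adj (a b : expr) : form := Atom (adj_expr a b).

Section Formulas.
Variable k : nat.

Definition Side : form :=
  ands [:: All 1 (Imp (InB (EReg 1))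
             (All 2 (Imp (InB (EReg 2)) (SameCol (EReg 1) (EReg 2)))));
           Ex 1 (And (InB (EReg 1))
             (Ex 2 (And (InB (EReg 2)) (Not (Eq (EReg 1) (EReg 2))))));
           All 1 (Imp (InA (EReg 1))
             (Ex 2 (And (InB (EReg 2)) (Not (Adj (EReg 1) (EReg 2))))))].

(* Registers 2 to [j + 1] hold the vertices of the satellite of register 1
   found so far, padded with the non-vertex [n] once it is exhausted. *)
Definition Fresh (j : nat) : form :=
  And (InA (EReg (2 + j)))
    (And (Or (Eq (EReg (2 + j)) (EReg 1)) (Adj (EReg 1) (EReg (2 + j))))
       (ands [seq Not (Eq (EReg (2 + j)) (EReg (2 + i))) | i <- iota 0 j])).

(** Each search sits in the continuation of the previous one, so the [r] loops run in sequence and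
    are not nested. *)
Fixpoint Collect (j r : nat) (g : form) : form :=
  if r is r'.+1 then Pick (Fresh j) (Collect j.+1 r' g) else g.

(** A set [X] is represented by a set [M] of register indices. There are [2 ^ k] of these,
    independently of the input, so the program can list them all. *)
Definition InTrace (M : {set 'I_k}) (a : expr) : form :=
  ors [seq Eq a (EReg (2 + i)) | i : 'I_k <- enum M].

Definition InExtension (M : {set 'I_k}) (a : expr) : form :=
  Or (InTrace M a)
    (And (InB a)
       (ands [seq Imp (IsVertex (EReg (2 + i))) (Adj a (EReg (2 + i)))
             | i : 'I_k <- enum M])).

(** The quantifier over the satellite in [bad_trace] becomes a conjunction over the [k] registers,
    so that only the loops over [y] remain. *)
Definition Trace (M : {set 'I_k}) : form :=
  let y := EReg (2 + k) in
  ands [:: InTrace M (EReg 1);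
           Ex (2 + k) (And (InExtension M y) (Not (Eq y (EReg 1))));
           All (2 + k) (Imp (InExtension M y) (SameCol y (EReg 1)));
           ands [seq Imp (IsVertex (EReg (2 + i)))
                       (Or (InTrace M (EReg (2 + i)))
                          (Ex (2 + k) (And (InExtension M y)
                                         (Not (Adj y (EReg (2 + i)))))))
                | i : 'I_k <- enum 'I_k]].

Definition CliqueColouring : form :=
  And (Not Side)
    (All 1 (Imp (InA (EReg 1))
       (Collect 0 k (Not (ors [seq Trace M | M <- enum {set 'I_k}]))))).

End Formulas.

Lemma size_lt n w : (n + 2) ^ 2 <= 2 ^ w -> n < 2 ^ w.
Proof. by apply: leq_trans; rewrite expnS expn1; nia. Qed.

(** * Meaning of the formulas on an encoded input *)

Section Encoding.
Variables (n : nat) (e : rel 'I_n) (A : {set 'I_n}) (col : 'I_n -> nat).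
Variable w : nat.
Hypothesis w_large : (n + 2) ^ 2 <= 2 ^ w.
Let m := nth 0 (encode e A col).

Lemma mem_size : m 0 = n. Proof. by []. Qed.

Let memS i : m i.+1 = nth 0 ([seq nat_of_bool (e i j) | i <- enum 'I_n, j <- enum 'I_n]
    ++ [seq nat_of_bool (i \in A) | i <- enum 'I_n]
    ++ [seq col i | i <- enum 'I_n]) i.
Proof. by []. Qed.

Let size_pairs : size [seq nat_of_bool (e i j) | i <- enum 'I_n, j <- enum 'I_n] = n * n.
Proof. by rewrite size_allpairs size_enum_ord. Qed.

Lemma mem_adj (i j : 'I_n) : m (1 + (i * n + j)) = e i j.
Proof.
rewrite add1n memS nth_cat size_pairs.
have lt_ij : i * n + j < n * n.
  by have := ltn_ord i; have := ltn_ord j; nia.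
rewrite lt_ij.
(* Induction over the list of rows: each row before row [p] contributes [n] entries. *)
have : forall (r : seq 'I_n) (p : nat), p < size r ->
   nth 0 [seq nat_of_bool (e i j) | i <- r, j <- enum 'I_n] (p * n + j) = e (nth i r p) j.
  elim=> // a r IH [|p] pr; rewrite [LHS]nth_cat size_map size_enum_ord.
    by rewrite mul0n add0n ltn_ord (nth_map j) ?size_enum_ord // nth_ord_enum.
  by rewrite mulSn -addnA ltnNge leq_addr addKn IH.
by move=> /(_ (enum 'I_n) i); rewrite size_enum_ord => -> //; rewrite nth_ord_enum.
Qed.

Lemma mem_inA (i : 'I_n) : m (1 + (n * n + i)) = (i \in A).
Proof.
rewrite add1n memS nth_cat size_pairs ltnNge leq_addr addKn nth_cat.
by rewrite size_map size_enum_ord ltn_ord (nth_map i) ?size_enum_ord // nth_ord_enum.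
Qed.

Lemma mem_col (i : 'I_n) : m (1 + (n * n + (n + i))) = col i.
Proof.
rewrite add1n memS nth_cat size_pairs ltnNge leq_addr addKn nth_cat.
rewrite size_map size_enum_ord ltnNge leq_addr addKn.
by rewrite (nth_map i) ?size_enum_ord // nth_ord_enum.
Qed.

Lemma den_Adj rg d a b (i j : 'I_n) :
    eval w (State rg m) a = i -> eval w (State rg m) b = j ->
  den w m rg d (Adj a b) = e i j.
Proof.
move=> ai bj; rewrite /= ai bj mod0n mem_size (modnDml (i * n)) modnDm.
rewrite modn_small ?mem_adj ?eqb0 ?negbK //; apply: leq_trans w_large.
by have := ltn_ord i; have := ltn_ord j; rewrite expnS expn1; nia.
Qed.

Lemma den_InA rg d a (i : 'I_n) : eval w (State rg m) a = i ->
  den w m rg d (InA a) = (i \in A).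
Proof.
move=> ai; rewrite /= ai mod0n mem_size (modnDml (n * n)) modnDm.
rewrite modn_small ?mem_inA ?eqb0 ?negbK //; apply: leq_trans w_large.
by have := ltn_ord i; rewrite expnS expn1; nia.
Qed.

Lemma eval_col rg a (i : 'I_n) : eval w (State rg m) a = i ->
  eval w (State rg m) (col_expr a) = col i.
Proof.
move=> /= ->; rewrite mod0n mem_size (modnDm (n * n)) modnDm.
(* The address is at most [n ^ 2 + 2 n], below [(n + 2) ^ 2], so it does not wrap around. *)
rewrite modn_small ?mem_col //; apply: leq_trans w_large.
by have := ltn_ord i; rewrite expnS expn1; nia.
Qed.

Lemma den_SameCol rg d a b (i j : 'I_n) :
    eval w (State rg m) a = i -> eval w (State rg m) b = j ->
  den w m rg d (SameCol a b) = (col i == col j).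
Proof.
move=> ai bj; rewrite -[LHS]/(nat_of_bool (eval w (State rg m) (col_expr a)
  == eval w (State rg m) (col_expr b)) != 0).
by rewrite (eval_col ai) (eval_col bj) eqb0 negbK.
Qed.

Lemma den_Eq rg d a b (i j : 'I_n) :
    eval w (State rg m) a = i -> eval w (State rg m) b = j ->
  den w m rg d (Eq a b) = (i == j).
Proof. by move=> ai bj; rewrite /= ai bj eqb0 negbK. Qed.

Lemma den_IsVertex rg d r : den w m rg d (IsVertex (EReg r)) = (rg r < n).
Proof. by rewrite /= mod0n mem_size eqb0 negbK. Qed.

Lemma den_InB rg d a (i : 'I_n) : eval w (State rg m) a = i ->
  den w m rg d (InB a) = (i \in ~: A).
Proof. by move=> ai; rewrite inE -(den_InA d ai). Qed.

Lemma den_Side rg : den w m rg 1 Side = bad_side e A (~: A) col.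
Proof.
rewrite den_ands 3!all_cons andbT; congr [&& _, _ & _].
- rewrite (den_All _ _ _ _ mem_size); apply: eq_forallb => x.
  rewrite den_Imp (den_InB _ (i := x)) //; congr (_ ==> _).
  rewrite (den_All _ _ _ _ mem_size); apply: eq_forallb => y.
  by rewrite den_Imp (den_InB _ (i := y)) ?(den_SameCol _ (i := x) (j := y)).
- rewrite (den_Ex _ _ _ _ mem_size); apply: eq_existsb => x.
  rewrite den_And (den_InB _ (i := x)) //; congr (_ && _).
  rewrite (den_Ex _ _ _ _ mem_size); apply: eq_existsb => y.
  by rewrite den_And (den_InB _ (i := y)) // den_Not (den_Eq _ (i := x) (j := y)).
- rewrite (den_All _ _ _ _ mem_size); apply: eq_forallb => x.
  rewrite den_Imp (den_InA _ (i := x)) //; congr (_ ==> _).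
  rewrite (den_Ex _ _ _ _ mem_size); apply: eq_existsb => y.
  by rewrite den_And (den_InB _ (i := y)) // den_Not (den_Adj _ (i := x) (j := y)).
Qed.

(** The padding value [n] is no element of ['I_n] and contributes nothing. *)
Definition listed (j : nat) (rg : nat -> nat) : {set 'I_n} :=
  [set y : 'I_n | has (fun i => rg (2 + i) == y) (iota 0 j)].

Lemma listed_upd j rg v :
  listed j.+1 (upd rg (2 + j) v) = listed j rg :|: [set y : 'I_n | v == y].
Proof.
apply/setP => y; rewrite !inE -[j.+1]addn1 iotaD has_cat /= orbF add0n /upd eqxx.
congr (_ || _); apply: eq_in_has => i; rewrite mem_iota => /andP[_ ij].
by rewrite eqn_add2l (ltn_eqF ij).
Qed.

Lemma den_Fresh j (rg : nat -> nat) (x y : 'I_n) : rg 1 = x ->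
  den w m (upd rg (2 + j) y) (2 + j).+1 (Fresh j)
  = (y \in satellite_of e A x :\: listed j rg).
Proof.
move=> rgx.
have ry : upd rg (2 + j) y (2 + j) = y by rewrite /upd eqxx.
have r1 : upd rg (2 + j) y 1 = x by rewrite /upd /= rgx.
rewrite 2!den_And den_Or (den_InA _ (i := y)) // (den_Eq _ (i := y) (j := x)) //.
rewrite (den_Adj _ (i := x) (j := y)) //; rewrite !inE andbA [RHS]andbC; congr (_ && _).
rewrite den_ands all_map -all_predC; apply: eq_in_all => i.
rewrite mem_iota => /andP[_ ij] /=.
by rewrite ry /upd eqn_add2l (ltn_eqF ij) eqb0 negbK eq_sym.
Qed.

(* The bound says that [r] more vertices exhaust the satellite. *)
Lemma den_Collect j r g (rg : nat -> nat) (x : 'I_n) : rg 1 = x ->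
    listed j rg \subset satellite_of e A x ->
    #|satellite_of e A x :\: listed j rg| <= r ->
  exists rg' : nat -> nat, [/\ den w m rg (2 + j) (Collect j r g)
                  = den w m rg' (2 + (j + r)) g,
                rg' 1 = x & listed (j + r) rg' = satellite_of e A x].
Proof.
elim: r j rg => [|r IH] j rg rgx sub.
  rewrite leqn0 cards_eq0 setD_eq0 => sup; exists rg; rewrite addn0; split=> //.
  by apply/eqP; rewrite eqEsubset sub.
move=> card_le; rewrite [Collect _ _ _]/= den_Pick.
set P := fun y => den w m (upd rg (2 + j) y) (2 + j).+1 (Fresh j).
pose v := find P (iota 0 n).
have PE (y : 'I_n) : P y = (y \in satellite_of e A x :\: listed j rg).
  exact: den_Fresh.
have [] := IH j.+1 (upd rg (2 + j) v).
- by [].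
- rewrite listed_upd subUset sub; apply/subsetP => y; rewrite inE => /eqP vy.
  have : P y.
    rewrite -vy /v -{1}[find _ _]add0n -(nth_iota 0 0 (n := n)); last by rewrite -/v vy.
    by apply: nth_find; rewrite has_find size_iota -/v vy.
  by rewrite PE inE => /andP[].
(* A successful search removes a vertex from the unlisted rest; a failed one shows that this rest is
   already empty. *)
- rewrite listed_upd -setDDl; case: (boolP (has P (iota 0 n))) => hasP.
    have vn : v < n by move: hasP; rewrite has_find size_iota.
    have vin : Ordinal vn \in satellite_of e A x :\: listed j rg.
      by rewrite -PE /= -{1}[v]add0n -(nth_iota 0 0 vn); exact: nth_find.
    move: card_le; rewrite (cardsD1 (Ordinal vn)) vin add1n ltnS.
    apply: leq_trans; apply/subset_leq_card/setDS/subsetP => y.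
    by rewrite !inE => /eqP ->.
  rewrite (_ : _ :\: listed j rg = set0) ?set0D ?cards0 //; apply/setP => y.
  rewrite -PE in_set0; apply/negbTE; apply: contra hasP => Py.
  by apply/hasP; exists (y : nat); rewrite // mem_iota /=.
- by move=> rg' [denE rg'x lst]; exists rg'; rewrite addnS -addSn; split.
Qed.

Section Traces.
Variables (k : nat) (rg : nat -> nat) (x : 'I_n).
Hypothesis rgx : rg 1 = x.

Definition trace_set (M : {set 'I_k}) : {set 'I_n} :=
  [set y : 'I_n | [exists i in M, rg (2 + i) == y]].

Let rg_upd y i : i < k -> upd rg (2 + k) y (2 + i) = rg (2 + i).
Proof. by move=> ik; rewrite /upd eqn_add2l (ltn_eqF ik). Qed.

(** The general [rg'] covers both uses, outside and under the binder of register [2 + k]. *)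
Lemma den_InTrace M rg' d a (y : 'I_n) :
    (forall i, i < k -> rg' (2 + i) = rg (2 + i)) ->
    eval w (State rg' m) a = y ->
  den w m rg' d (InTrace M a) = (y \in trace_set M).
Proof.
move=> rgE ay; rewrite den_ors has_map inE; apply/hasP/exists_inP => -[i iM].
  move=> /=; rewrite ay rgE // eqb0 negbK eq_sym => h; exists i => //.
  by rewrite mem_enum in iM.
move=> h; exists i; first by rewrite mem_enum.
by rewrite /= ay rgE // eqb0 negbK eq_sym.
Qed.

Lemma den_InExtension M (y : 'I_n) :
  den w m (upd rg (2 + k) y) (2 + k).+1 (InExtension M (EReg (2 + k)))
  = (y \in extension e (~: A) (trace_set M)).
Proof.
have ry : eval w (State (upd rg (2 + k) y) m) (EReg (2 + k)) = y.
  by rewrite /= /upd eqxx.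
rewrite den_Or (den_InTrace M _ _ ry); last by move=> i; exact: rg_upd.
rewrite den_And (den_InB _ ry) in_setU; congr (_ || _); rewrite [RHS]inE.
congr (_ && _); rewrite den_ands all_map; apply/allP/forall_inP => [H z|H i iM].
  rewrite inE => /exists_inP[i iM /eqP rz].
  have := H i; rewrite mem_enum => /(_ iM); rewrite [preim _ _ _]den_Imp den_IsVertex.
  rewrite rg_upd // rz ltn_ord (den_Adj _ ry (j := z)) //.
  by rewrite /= rg_upd.
rewrite [preim _ _ _]den_Imp den_IsVertex rg_upd //; apply/implyP => rn.
rewrite (den_Adj _ ry (j := Ordinal rn)); last by rewrite /= rg_upd.
by apply: H; rewrite inE; apply/exists_inP; exists i; rewrite // -mem_enum.
Qed.

Lemma den_Trace M : listed k rg = satellite_of e A x ->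
  den w m rg (2 + k) (Trace M) = bad_trace e A (~: A) col x (trace_set M).
Proof.
move=> lst; rewrite den_ands 4!all_cons andbT.
have ry y : eval w (State (upd rg (2 + k) y) m) (EReg (2 + k)) = y.
  by rewrite /= /upd eqxx.
congr [&& _, _, _ & _].
- exact: den_InTrace.
- rewrite (den_Ex _ _ _ _ mem_size); apply: eq_existsb => y.
  by rewrite den_And den_InExtension den_Not (den_Eq _ (ry y) (j := x)).
- rewrite (den_All _ _ _ _ mem_size); apply: eq_forallb => y.
  by rewrite den_Imp den_InExtension (den_SameCol _ (ry y) (j := x)).
rewrite den_ands all_map.
have inner (i : 'I_k) (z : 'I_n) : rg (2 + i) = z ->
    den w m rg (2 + k) (Or (InTrace M (EReg (2 + i)))
       (Ex (2 + k) (And (InExtension M (EReg (2 + k)))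
                      (Not (Adj (EReg (2 + k)) (EReg (2 + i)))))))
    = (z \in trace_set M) ||
      [exists y, (y \in extension e (~: A) (trace_set M)) && ~~ e y z].
  move=> rz; rewrite den_Or (den_InTrace M _ (y := z)) //; congr (_ || _).
  rewrite (den_Ex _ _ _ _ mem_size); apply: eq_existsb => y.
  rewrite den_And den_InExtension den_Not (den_Adj _ (ry y) (j := z)) //.
  by rewrite /= rg_upd.
(* The registers that hold a vertex list exactly the satellite, so both quantifiers range over the
   same vertices. *)
apply/allP/forallP => [H z|H i _].
  apply/implyP; rewrite -lst inE => /hasP[i]; rewrite mem_iota /= => ik /eqP rz.
  have := H (Ordinal ik) (mem_enum _ _); rewrite [preim _ _ _]den_Imp den_IsVertex.
  by rewrite rz ltn_ord (inner (Ordinal ik) z).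
rewrite [preim _ _ _]den_Imp den_IsVertex; apply/implyP => rn.
rewrite (inner i (Ordinal rn)) //; apply: (implyP (H (Ordinal rn))).
by rewrite -lst inE; apply/hasP; exists (i : nat); rewrite ?mem_iota /=.
Qed.

Lemma trace_set_subset M : listed k rg = satellite_of e A x ->
  trace_set M \subset satellite_of e A x.
Proof.
move=> <-; apply/subsetP => y; rewrite !inE => /exists_inP[i _ rz].
by apply/hasP; exists (i : nat); rewrite ?mem_iota /=.
Qed.

(** Take for [M] the registers whose content lies in [X]. Hence the disjunction over all [M] covers
    every subset of the satellite. *)
Lemma trace_set_surj (X : {set 'I_n}) : listed k rg = satellite_of e A x ->
  X \subset satellite_of e A x -> exists M, trace_set M = X.
Proof.
move=> lst XS; exists [set i : 'I_k | [exists y in X, rg (2 + i) == val y]].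
apply/setP => y; rewrite inE; apply/exists_inP/idP => [[i]|yX].
  rewrite inE => /exists_inP[z zX /eqP ->] /eqP zy.
  by rewrite -(val_inj zy).
have := subsetP XS y yX; rewrite -lst inE => /hasP[i].
rewrite mem_iota /= => ik ry; exists (Ordinal ik) => //.
by rewrite inE; apply/exists_inP; exists y.
Qed.

End Traces.

Lemma den_CliqueColouring k rg :
    symmetric e -> polar_partition e k A (~: A) ->
  den w m rg 1 (CliqueColouring k) = clique_colouring e col.
Proof.
move=> e_sym polarA; rewrite (clique_colouring_bad e_sym polarA).
rewrite /CliqueColouring den_And den_Not den_Side.
congr (_ && _); rewrite (den_All _ _ _ _ mem_size); apply: eq_forallb => x.
rewrite den_Imp (den_InA _ (i := x)) //; case: (boolP (x \in A)) => // xA /=.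
(* Nothing is listed at first, and [k] searches suffice because the satellite has at most [k]
   vertices. *)
have [||| rg' []] := @den_Collect 0 k
  (Not (ors [seq Trace M | M <- enum {set 'I_k}])) (upd rg 1 x) x.
- by [].
- by apply/subsetP => y; rewrite inE.
- by rewrite (leq_trans (subset_leq_card (subsetDl _ _))) // (satellite_card polarA).
rewrite !add0n => -> rgx lst.
rewrite den_Not den_ors has_map; congr (~~ _).
apply/hasP/existsP => [[M _]|[X /andP[XS bt]]].
  rewrite [preim _ _ _](den_Trace rgx M lst) => bt; exists (trace_set rg' M).
  by rewrite bt trace_set_subset.
have [M MX] := trace_set_surj lst XS; exists M; first by rewrite mem_enum.
by rewrite [preim _ _ _](den_Trace rgx M lst) MX.
Qed.

End Encoding.

(** * Quantifier depth and scoping of the formula *)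

Lemma depth_Collect b j r g :
  0 < b -> depth g <= b -> depth (Collect j r g) <= b.
Proof.
move=> b_gt0 gb; elim: r j => //= r IH j; rewrite geq_max IH andbT.
rewrite !max0n (leq_ltn_trans _ b_gt0) //.
by apply: depth_ands; rewrite all_map; apply/allP.
Qed.

Lemma depth_InExtension k (M : {set 'I_k}) a : depth (InExtension M a) = 0.
Proof.
apply/eqP; rewrite -leqn0 /= max0n geq_max; apply/andP; split.
  by apply: depth_ands; rewrite !all_map; apply/allP.
by apply: depth_ands; rewrite !all_map; apply/allP.
Qed.

Lemma depth_All d f : depth (All d f) = (depth f).+1.
Proof. by rewrite /= maxn0. Qed.

Lemma depth_Ex d f : depth (Ex d f) = (depth f).+1.
Proof. by rewrite /= maxn0. Qed.

Lemma depth_And f g : depth (And f g) = maxn (depth f) (depth g).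
Proof. by []. Qed.

Lemma depth_Or f g : depth (Or f g) = maxn (depth f) (depth g).
Proof. by []. Qed.

Lemma depth_Imp f g : depth (Imp f g) = maxn (depth f) (depth g).
Proof. by []. Qed.

Lemma depth_Trace k (M : {set 'I_k}) : depth (Trace M) <= 1.
Proof.
apply: depth_ands; apply/and5P; split=> //.
- by apply: depth_ors; rewrite all_map; apply/allP.
- by rewrite depth_Ex depth_And depth_InExtension.
- by rewrite depth_All depth_Imp depth_InExtension.
apply: depth_ands; rewrite all_map; apply/allP => i _.
change (depth (Imp (IsVertex (EReg (2 + i))) (Or (InTrace M (EReg (2 + i)))
  (Ex (2 + k) (And (InExtension M (EReg (2 + k)))
    (Not (Adj (EReg (2 + k)) (EReg (2 + i)))))))) <= 1).
rewrite depth_Imp depth_Or depth_Ex depth_And depth_InExtension max0n.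
rewrite [maxn 0 _]max0n geq_max andbT.
by apply: depth_ands; rewrite !all_map; apply/allP.
Qed.

(** [Side] nests two quantifiers. In the other conjunct, the loop over the vertices of [A] encloses
    searches with quantifier-free bodies and the formulas [Trace M], all of depth at most 1. *)
Lemma depth_CliqueColouring k : depth (CliqueColouring k) <= 2.
Proof.
rewrite depth_And geq_max; apply/andP; split=> //.
rewrite depth_All depth_Imp ltnS [maxn _ _]max0n.
apply: depth_Collect => //; apply: depth_ors; rewrite all_map.
by apply/allP => M _; apply: depth_Trace.
Qed.

Lemma form_ok_All d f : 0 < d -> form_ok d (All d f) = form_ok d.+1 f.
Proof. by move=> d_gt0; rewrite /= d_gt0 ltnSn !andbT. Qed.

Lemma form_ok_Ex d f : 0 < d -> form_ok d (Ex d f) = form_ok d.+1 f.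
Proof. exact: form_ok_All. Qed.

Lemma form_ok_And d f g : form_ok d (And f g) = form_ok d f && form_ok d g.
Proof. by []. Qed.

Lemma form_ok_Or d f g : form_ok d (Or f g) = form_ok d f && form_ok d g.
Proof. by []. Qed.

Lemma form_ok_Imp d f g : form_ok d (Imp f g) = form_ok d f && form_ok d g.
Proof. by []. Qed.

Lemma form_ok_Collect j r g :
  form_ok (2 + (j + r)) g -> form_ok (2 + j) (Collect j r g).
Proof.
elim: r j => [|r IH] j; first by rewrite addn0.
rewrite addnS -addSn => /IH okg /=; rewrite okg andbT form_ok_ands all_map !ltnS leqnn.
by apply/allP => i; rewrite mem_iota => /andP[_ ij]; rewrite /= !ltnS leqnn ltnW.
Qed.

Lemma form_ok_Trace k (M : {set 'I_k}) : form_ok (2 + k) (Trace M).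
Proof.
have okr d (i : 'I_k) : k <= d -> 0 < 2 + i < 2 + d.
  by move=> kd; rewrite ltn_add2l (leq_trans (ltn_ord i)).
have okT d a : k <= d -> expr_ok (2 + d) a -> form_ok (2 + d) (InTrace M a).
  move=> kd oka; rewrite form_ok_ors all_map; apply/allP => i _.
  by rewrite /= oka okr.
have okE d a : k <= d -> expr_ok (2 + d) a -> form_ok (2 + d) (InExtension M a).
  move=> kd oka; rewrite form_ok_Or okT // form_ok_And.
  rewrite form_ok_ands all_map [form_ok _ _]oka.
  apply/allP => i _; rewrite /= oka okr // !andbT; by case/andP: (okr d i kd).
rewrite form_ok_ands; apply/and5P; split=> //.
- exact: okT.
- by rewrite form_ok_Ex // form_ok_And (okE k.+1) //= !ltnS leqnn.
- by rewrite form_ok_All // form_ok_Imp (okE k.+1) //= !ltnS leqnn.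
rewrite form_ok_ands all_map; apply/allP => i _.
change (form_ok (2 + k) (Imp (IsVertex (EReg (2 + i))) (Or (InTrace M (EReg (2 + i)))
  (Ex (2 + k) (And (InExtension M (EReg (2 + k)))
    (Not (Adj (EReg (2 + k)) (EReg (2 + i))))))))).
rewrite form_ok_Imp form_ok_Or form_ok_Ex // form_ok_And (okE k.+1) //; last first.
  by rewrite /= ltnSn.
rewrite okT //; last exact: okr.
by rewrite /= !andbT !ltnS leqnn (ltnW (ltn_ord i)) ltn_ord.
Qed.

Lemma form_ok_CliqueColouring k : form_ok 1 (CliqueColouring k).
Proof.
rewrite form_ok_And form_ok_All // form_ok_Imp.
apply: (form_ok_Collect (j := 0)).
rewrite -[form_ok _ _]/(form_ok (2 + k) (ors _)) form_ok_ors all_map.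
by apply/allP => M _; apply: form_ok_Trace.
Qed.

(** * The program and its quadratic running time *)

Theorem theorem3 (k : nat) (k_ge1 : 1 <= k) :
  exists (P : cmd) (c : nat) (time : nat -> nat),
    bigO time (fun n => n ^ 2) /\
    forall (n : nat) (e : rel 'I_n) (A B : {set 'I_n}) (col : 'I_n -> nat)
           (w : nat),
      simple_graph e ->
      polar_partition e k A B ->
      word_size_ok c n w (encode e A col) ->
      exists (t : nat) (s : state),
        [/\ exec w P (init (encode e A col)) t s,
            t <= time n &
            output s = nat_of_bool (clique_colouring e col)].
Proof.
(* Compilation only determines whether register 0 is zero; the final assignment, of cost 4,
   normalises it to 0 or 1. The word constant 2 makes all addresses fit. *)
exists (CSeq (compile 1 (CliqueColouring k))
             (CAssign 0 (ELt (EConst 0) (EReg 0)))), 2,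
  (fun n => cost n (CliqueColouring k) + 4); split.
  have [C costC] := cost_polynomial (CliqueColouring k).
  (* For [n >= 1], [(n + 1) ^ 2] is at most [(2 n) ^ 2 = 4 n ^ 2]; the second 4 pays for the final
     assignment. *)
  exists (C * 4 + 4), 1 => n n_gt0; rewrite mulnDl leq_add //; last first.
    by rewrite leq_pmulr // expn_gt0 n_gt0.
  apply: leq_trans (costC n) _; rewrite -mulnA leq_mul2l; apply/orP; right.
  apply: leq_trans (_ : n.+1 ^ 2 <= _).
    by rewrite leq_pexp2l // depth_CliqueColouring.
  by rewrite -(expnMn 2 n 2) leq_exp2r // mul2n -addnn -addn1 leq_add2l.
move=> n e A B col w [e_sym _] polarAB [w_large _].
(* The input stores [A] alone, so the formulas describe [B] as its complement. *)
have BE : B = ~: A.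
  by apply/setP => x; rewrite inE (notinA polarAB).
rewrite {}BE in polarAB.
have [t [rg [ex tle res _]]] := compile_correct (m := nth 0 (encode e A col))
  (ltn0Sn 0) (size_lt w_large) (form_ok_CliqueColouring k) (fun=> 0).
exists (t + 4), (State (upd rg 0 (0 < rg 0)) (nth 0 (encode e A col))); split.
- apply: ExecSeq ex _.
  have -> : (0 < rg 0) = eval w (State rg (nth 0 (encode e A col)))
      (ELt (EConst 0) (EReg 0)) :> nat by rewrite /= mod0n.
  exact: ExecAssign.
- by rewrite leq_add2r.
- by rewrite /output /upd /= lt0n res den_CliqueColouring.
Qed.
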